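(* Let $p$ be a prime, let $q$ be a power of $p$, and let $n$ and $r$ be positive integers with $p\geq n$. Let $\mathbf{G}$ be either $\mathrm{GL}_n$ or $\mathrm{SL}_n$, and let $F$ be a perfect field of the same characteristic $p$ as $\mathbb{F}_q$. Then the group algebras $F[\mathbf{G}(W_r(\mathbb{F}_q))]$ and $F[\mathbf{G}(\mathbb{F}_q[t]/t^r)]$ are not isomorphic (as $F$-algebras) in each of the following cases: \begin{itemize} \item $r=2$ and $p\geq 2n$; \item $r=3$ and $p\geq 3$; \item $r\geq 4$ and $p\geq 2$. \end{itemize}
   Context: $\mathbb{F}_q$ is the finite field with $q$ elements, and $W_r(\mathbb{F}_q)$ denotes the ring of Witt vectors of length $r$ with residue field $\mathbb{F}_q$. For a finite group $G$, $F[G]$ is its group algebra over $F$.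
   Formalization: For n=1 the claim is restricted to GL_1 with r≥3, and r≥6 if q=2; in the excluded cases (SL_1; GL_1 with r=2; GL_1 with q=2 and r=4 or 5) the two groups are isomorphic, so the statement as written is false there. *)

(* Defs.v *)
From HB Require Import structures.
From mathcomp Require Import all_boot all_order all_algebra all_fingroup.
From mathcomp Require Import all_field ring.
From mathcomp.multinomials Require Import mpoly.

Set Implicit Arguments.
Unset Strict Implicit.
Unset Printing Implicit Defensive.

Import Order.TTheory GRing.Theory Num.Theory.
Local Open Scope ring_scope.

Section WittPolynomials.

Variable p : nat.

(* the n-th Witt polynomial w_n = \sum_(i <= n) p^i X_i^(p^(n-i)), at X := x *)
Definition ghost (R : comNzRingType) (x : nat -> R) (n : nat) : R :=
  \sum_(i < n.+1) x i ^+ (p ^ (n - i)) *+ (p ^ i).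

Section Unghost.

Variable m : nat.
Implicit Types T : nat -> {mpoly int[m]}.

Definition mpoly_divn (d : nat) (f : {mpoly int[m]}) : {mpoly int[m]} :=
  map_mpoly (fun c => (c %/ d%:Z)%Z) f.

(* [unghost T] is the solution U of ghost U n = T n for all n; the division
   by p^n is exact for the T used below, see ghost_unghost. *)
Fixpoint unghost_seq T (n : nat) : seq {mpoly int[m]} :=
  if n is k.+1 then
    let U := unghost_seq T k in
    rcons U (mpoly_divn (p ^ k)
               (T k - \sum_(i < k) U`_i ^+ (p ^ (k - i)) *+ (p ^ i)))
  else [::].

Definition unghost T (n : nat) : {mpoly int[m]} := (unghost_seq T n.+1)`_n.

End Unghost.

Section Operations.

Variable r : nat.
Local Notation L := r.-1.+1.

(* Only the indices k < L matter: the k-th polynomials below involve only the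
   variables of index <= k, and witt_add, etc. only use those with k < L, so
   the truncation made by inord is harmless. *)
Definition Xvar (k : nat) : {mpoly int[L + L]} := 'X_(lshift L (inord k)).
Definition Yvar (k : nat) : {mpoly int[L + L]} := 'X_(rshift L (inord k)).
Definition Zvar (k : nat) : {mpoly int[L]} := 'X_(inord k).

Definition wadd_poly : nat -> {mpoly int[L + L]} :=
  unghost (fun n => ghost Xvar n + ghost Yvar n).
Definition wmul_poly : nat -> {mpoly int[L + L]} :=
  unghost (fun n => ghost Xvar n * ghost Yvar n).
Definition wopp_poly : nat -> {mpoly int[L]} :=
  unghost (fun n => - ghost Zvar n).

End Operations.
End WittPolynomials.

Section Congruence.

Variable R : comNzRingType.
Implicit Types (a b c : R) (d : nat).

Definition congr_modn d a b := exists c, a = b + d%:R * c.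

Lemma congrn_refl d a : congr_modn d a a.
Proof. by exists 0; rewrite mulr0 addr0. Qed.

Lemma congrn_sym d a b : congr_modn d a b -> congr_modn d b a.
Proof. by case=> c ->; exists (- c); ring. Qed.

Lemma congrn_trans d a b c :
  congr_modn d a b -> congr_modn d b c -> congr_modn d a c.
Proof. by case=> e -> [f ->]; exists (f + e); ring. Qed.

Lemma congrnD d a b a' b' :
  congr_modn d a b -> congr_modn d a' b' -> congr_modn d (a + a') (b + b').
Proof. by case=> e -> [f ->]; exists (e + f); ring. Qed.

Lemma congrnN d a b : congr_modn d a b -> congr_modn d (- a) (- b).
Proof. by case=> e ->; exists (- e); ring. Qed.

Lemma congrnM d a b a' b' :
  congr_modn d a b -> congr_modn d a' b' -> congr_modn d (a * a') (b * b').
Proof. by case=> e -> [f ->]; exists (b * f + e * b' + d%:R * e * f); ring. Qed.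

Lemma congrnX d a b k : congr_modn d a b -> congr_modn d (a ^+ k) (b ^+ k).
Proof.
move=> ab; elim: k => [|k IH]; first exact: congrn_refl.
by rewrite !exprS; apply: congrnM.
Qed.

Lemma congrn_sum n d (F G : 'I_n -> R) :
  (forall i, congr_modn d (F i) (G i)) ->
  congr_modn d (\sum_i F i) (\sum_i G i).
Proof.
move=> FG; elim/big_rec2: _ => [|i y1 y2 _ IH]; first exact: congrn_refl.
exact: congrnD.
Qed.

Lemma congrn_scale d e a b :
  congr_modn d a b -> congr_modn (e * d) (a *+ e) (b *+ e).
Proof. by case=> c ->; exists c; rewrite natrM -[LHS]mulr_natl -[b *+ e]mulr_natl; ring. Qed.

Lemma congrn_dvd d e a b : (e %| d)%N -> congr_modn d a b -> congr_modn e a b.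
Proof. by case/dvdnP=> k -> [c ->]; exists (k%:R * c); rewrite natrM; ring. Qed.

Variable p : nat.
Hypothesis p_pr : prime p.

Lemma congrn_Frob_add a b : congr_modn p ((a + b) ^+ p) (a ^+ p + b ^+ p).
Proof.
have [k pE] : exists k, p = k.+1 by case: p p_pr => [|k] // _; exists k.
exists (\sum_(i < k) a ^+ (p - i.+1) * b ^+ i.+1 *+ ('C(p, i.+1) %/ p)%N).
have sumE (F : nat -> R) :
    \sum_(i < p.+1) F i = F 0%N + \sum_(i < k) F i.+1 + F p.
  by rewrite pE big_ord_recr big_ord_recl.
rewrite exprDn (sumE (fun i => a ^+ (p - i) * b ^+ i *+ 'C(p, i))).
rewrite bin0 binn subn0 subnn !expr0 mulr1 mul1r !mulr1n addrAC.
congr (_ + _); rewrite big_distrr /=; apply: eq_bigr => i _.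
rewrite mulr_natl -mulrnA divnK //.
by rewrite prime_dvd_bin //= pE ltnS ltn_ord.
Qed.

Lemma congrn_Frob_opp a : congr_modn p ((- a) ^+ p) (- a ^+ p).
Proof.
have := congrn_Frob_add a (- a).
rewrite subrr expr0n; rewrite (gtn_eqF (prime_gt0 p_pr)) => -[c E].
exists (- c); have -> : (- a) ^+ p = (a ^+ p + (- a) ^+ p + p%:R * c) - a ^+ p - p%:R * c by ring.
by rewrite -E /=; ring.
Qed.

Lemma congrn_lift j a b :
  congr_modn (p ^ j.+1) a b -> congr_modn (p ^ j.+2) (a ^+ p) (b ^+ p).
Proof.
move=> ab; have abp : congr_modn p a b.
  by apply: congrn_dvd ab; rewrite expnS dvdn_mulr.
have [e eE] : congr_modn p (\sum_(i < p) a ^+ (p.-1 - i) * b ^+ i) 0.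
  apply: (@congrn_trans _ _ (\sum_(i < p) b ^+ p.-1)).
    apply: congrn_sum => i; have ile : (i <= p.-1)%N.
      by rewrite -ltnS (leq_trans (ltn_ord i)) ?leqSpred.
    rewrite -{2}(subnK ile) exprD.
    by apply: congrnM; [apply: congrnX | apply: congrn_refl].
  by exists (b ^+ p.-1); rewrite big_const_ord iter_addr_0 add0r mulr_natl.
have := subrXX a b p; rewrite eE; case: ab => c ->.
move=> E; exists (c * e).
rewrite -[LHS](subrK (b ^+ p)) E (expnS p j.+1) natrM; ring.
Qed.

Lemma congrn_lift_iter j a b :
  congr_modn p a b -> congr_modn (p ^ j.+1) (a ^+ (p ^ j)) (b ^+ (p ^ j)).
Proof.
move=> ab; elim: j => [|j IH]; first by rewrite expn1 expn0 !expr1.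
by rewrite (expnSr p j) !exprM; apply: congrn_lift.
Qed.

End Congruence.

Section Integrality.

Variables (p : nat) (m : nat).
Hypothesis p_pr : prime p.
Local Notation M := {mpoly int[m]}.

Definition frob_lift : M -> M := mmap intr (fun i => 'X_i ^+ p).

Lemma frob_lift_congr (f : M) : congr_modn p (frob_lift f) (f ^+ p).
Proof.
pose P (g : M) := congr_modn p (frob_lift g) (g ^+ p).
have PD g h : P g -> P h -> P (g + h).
  move=> Pg Ph; rewrite /P /frob_lift raddfD /=.
  exact: congrn_trans (congrnD Pg Ph) (congrn_sym (congrn_Frob_add p_pr g h)).
have PN g : P g -> P (- g).
  move=> Pg; rewrite /P /frob_lift raddfN /=.
  exact: congrn_trans (congrnN Pg) (congrn_sym (congrn_Frob_opp p_pr g)).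
have PM g h : P g -> P h -> P (g * h).
  by move=> Pg Ph; rewrite /P /frob_lift rmorphM /= exprMn; apply: congrnM.
have P1 : P 1 by rewrite /P /frob_lift rmorph1 expr1n; apply: congrn_refl.
have P0 : P 0.
  rewrite /P /frob_lift raddf0 expr0n.
  by rewrite (gtn_eqF (prime_gt0 p_pr)); apply: congrn_refl.
have PC c : P (c%:MP).
  have Pn (k : nat) : P (k%:Z%:MP).
    elim: k => [|k IH]; first by rewrite mpolyC0.
    by rewrite intS mpolyCD; apply: PD.
  case: c => k; first exact: Pn.
  by rewrite NegzE mpolyCN; apply/PN/Pn.
have PX i : P 'X_i.
  by rewrite /P /frob_lift mmapX mmap1U; apply: congrn_refl.
have PXn i k : P ('X_i ^+ k).
  by elim: k => [|k IH]; rewrite ?expr0 // exprS; apply: PM.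
rewrite -/(P f); elim/mpolyind: f => [//|c u g _ _ Pg].
apply: (PD) => //; rewrite -mul_mpolyC; apply: (PM) => //.
by rewrite mpolyXE_id; apply: (big_ind P) => // i _; apply: PXn.
Qed.

Lemma mpoly_divnK d (f : M) : (0 < d)%N -> mpoly_divn d (d%:R * f) = f.
Proof.
move=> d0; apply/mpolyP => k.
rewrite /mpoly_divn /map_mpoly /mmap raddf_sum /=.
have cE u : (d%:R * f)@_u = d%:Z * f@_u by rewrite mulr_natl mcoeffMn -mulr_natl natz.
have dK u : ((d%:R * f)@_u %/ d)%Z = f@_u.
  by rewrite cE mulrC mulzK // -lt0n.
rewrite (eq_bigr (fun u => f@_u * (u == k)%:R)); last first.
  move=> u _; rewrite mcoeffCM dK -mcoeffX; congr (_ * _@__).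
  by rewrite mmap1_id.
case: (boolP (k \in msupp (d%:R * f))) => [kin|].
  rewrite (bigD1_seq k) ?msupp_uniq //= eqxx mulr1 big1 ?addr0 //.
  by move=> u /negPf ->; rewrite mulr0.
move=> knin; have fk0 : f@_k = 0 by rewrite -dK memN_msupp_eq0 // div0z.
rewrite fk0 big1_seq // => u /andP[_ uin].
by case: eqP => [E|_]; [rewrite -E uin in knin | rewrite mulr0].
Qed.

Lemma size_unghost_seq (T : nat -> M) n : size (unghost_seq p T n) = n.
Proof. by elim: n => //= n IH; rewrite size_rcons IH. Qed.

Lemma nth_unghost_seq (T : nat -> M) n i : (i < n)%N ->
  (unghost_seq p T n)`_i = unghost p T i.
Proof.
elim: n => // n IH; rewrite ltnS leq_eqVlt => /predU1P[-> //|lt].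
by rewrite /= nth_rcons size_unghost_seq lt IH.
Qed.

Lemma unghostE (T : nat -> M) n : unghost p T n =
  mpoly_divn (p ^ n)
    (T n - \sum_(i < n) unghost p T i ^+ (p ^ (n - i)) *+ (p ^ i)).
Proof.
rewrite {1}/unghost /= nth_rcons size_unghost_seq ltnn eqxx.
by congr (mpoly_divn _ (_ - _)); apply: eq_bigr => i _; rewrite nth_unghost_seq.
Qed.

(* Dwork's lemma: under this congruence the divisions in unghost are exact *)
Definition dwork (T : nat -> M) :=
  forall n, congr_modn (p ^ n.+1) (T n.+1) (frob_lift (T n)).

Lemma ghost_unghost (T : nat -> M) n :
  dwork T -> ghost p (unghost p T) n = T n.
Proof.
move=> dT.
have p_gt0 k : (0 < p ^ k)%N by rewrite expn_gt0 prime_gt0.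
have step k : congr_modn (p ^ k)
    (T k) (\sum_(i < k) unghost p T i ^+ (p ^ (k - i)) *+ (p ^ i)) ->
    ghost p (unghost p T) k = T k.
  case=> c E; rewrite /ghost big_ord_recr /= subnn expn0 expr1 unghostE E.
  by rewrite [X in mpoly_divn _ X]addrAC subrr add0r mpoly_divnK // mulr_natl.
elim: n => [|n IH]; apply: step.
  by exists (T 0%N); rewrite big_ord0 expn0 add0r mul1r.
apply: congrn_trans (dT n) _; rewrite -IH /ghost /frob_lift raddf_sum /=.
apply: congrn_sum => i; rewrite rmorphMn rmorphXn /= -/(frob_lift _).
have ile : (i <= n)%N by rewrite -ltnS.
rewrite -{1}(subnKC ile) -addnS expnD subSn //; apply: congrn_scale.
rewrite [X in congr_modn _ _ (_ ^+ X)]expnS exprM; apply: congrn_lift_iter => //.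
exact: frob_lift_congr.
Qed.

Lemma frob_lift_ghost (X : nat -> M) n :
  (forall i, frob_lift (X i) = X i ^+ p) ->
  congr_modn (p ^ n.+1) (ghost p X n.+1) (frob_lift (ghost p X n)).
Proof.
move=> FX; exists (X n.+1); rewrite /ghost big_ord_recr /= subnn expn0 expr1 mulr_natl.
congr (_ + _); rewrite /frob_lift raddf_sum /=; apply: eq_bigr => i _.
rewrite rmorphMn rmorphXn /= -/(frob_lift _) FX -exprM -expnS.
by rewrite subSn // -ltnS.
Qed.

End Integrality.

(* Witt vectors of length r over A; r.-1.+1 is r for r > 0, and makes the ring
   nontrivial in all cases, as in {'GL_n[R]}. A record rather than an alias of
   {ffun _ -> A}, which already has a (pointwise) ring structure. *)
Record witt (p : nat) (p_pr : prime p) (r : nat) (A : Type) :=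
  Witt { wcoord :> {ffun 'I_r.-1.+1 -> A} }.

Section PairVal.
Variables (A : Type) (m n : nat).
Definition pair_val (x : 'I_m -> A) (y : 'I_n -> A) (i : 'I_(m + n)) : A :=
  match split i with inl j => x j | inr j => y j end.
End PairVal.

(* Locked, to keep unification from unfolding the Witt polynomials. *)
HB.lock Definition witt_add (p : nat) (p_pr : prime p) (r : nat)
    (A : comNzRingType) (x y : witt p_pr r A) : witt p_pr r A :=
  Witt p_pr [ffun k : 'I_r.-1.+1 => mmap intr (pair_val x y) (wadd_poly p r k)].
HB.lock Definition witt_mul (p : nat) (p_pr : prime p) (r : nat)
    (A : comNzRingType) (x y : witt p_pr r A) : witt p_pr r A :=
  Witt p_pr [ffun k : 'I_r.-1.+1 => mmap intr (pair_val x y) (wmul_poly p r k)].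
HB.lock Definition witt_opp (p : nat) (p_pr : prime p) (r : nat)
    (A : comNzRingType) (x : witt p_pr r A) : witt p_pr r A :=
  Witt p_pr [ffun k : 'I_r.-1.+1 => mmap intr x (wopp_poly p r k)].

Arguments witt_add {p p_pr r A}.
Arguments witt_mul {p p_pr r A}.
Arguments witt_opp {p p_pr r A}.

Section WittRing.

Variables (p : nat) (p_pr : prime p) (r : nat).
Local Notation L := r.-1.+1.
Local Notation W := (witt p_pr r).

HB.instance Definition _ (A : Type) := [isNew for @wcoord p p_pr r A].
HB.instance Definition _ (A : eqType) := [Equality of W A by <:].
HB.instance Definition _ (A : choiceType) := [Choice of W A by <:].
HB.instance Definition _ (A : countType) := [Countable of W A by <:].
HB.instance Definition _ (A : finType) := [Finite of W A by <:].

Lemma wittP (A : Type) (x y : W A) : x =1 y -> x = y.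
Proof. by case: x y => [x] [y] /= /ffunP ->. Qed.

Section Ops.

Variable A : comNzRingType.
Implicit Types x y z : W A.

Definition witt_zero : W A := Witt p_pr [ffun=> 0].
Definition witt_one : W A := Witt p_pr [ffun k : 'I_L => (k == ord0)%:R].

Lemma witt_addE x y k :
  witt_add x y k = mmap intr (pair_val x y) (wadd_poly p r k).
Proof. by rewrite unlock ffunE. Qed.

Lemma witt_mulE x y k :
  witt_mul x y k = mmap intr (pair_val x y) (wmul_poly p r k).
Proof. by rewrite unlock ffunE. Qed.

Lemma witt_oppE x k : witt_opp x k = mmap intr x (wopp_poly p r k).
Proof. by rewrite unlock ffunE. Qed.

Definition wghost x (n : nat) : A := ghost p (fun i => x (inord i)) n.

Lemma eq_ghost (u v : nat -> A) n :
  (forall i, (i <= n)%N -> u i = v i) -> ghost p u n = ghost p v n.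
Proof. by move=> uv; apply: eq_bigr => i _; rewrite uv // -ltnS. Qed.

End Ops.

Lemma rmorph_ghost (A B : comNzRingType) (f : {rmorphism A -> B}) u n :
  f (ghost p u n) = ghost p (fun i => f (u i)) n.
Proof.
by rewrite rmorph_sum; apply: eq_bigr => i _; rewrite rmorphMn rmorphXn.
Qed.

Section Ghost.

Variable A : comNzRingType.
Implicit Types x y z : W A.

Lemma frobX m (i : 'I_m) : frob_lift p 'X_i = 'X_i ^+ p.
Proof. by rewrite /frob_lift mmapX mmap1U. Qed.

Lemma dwork_add : dwork p (fun n => ghost p (Xvar r) n + ghost p (Yvar r) n).
Proof.
move=> n; rewrite /frob_lift rmorphD /=.
by apply: congrnD; apply: frob_lift_ghost => // i; apply: frobX.
Qed.

Lemma dwork_mul : dwork p (fun n => ghost p (Xvar r) n * ghost p (Yvar r) n).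
Proof.
move=> n; rewrite /frob_lift rmorphM /=.
by apply: congrnM; apply: frob_lift_ghost => // i; apply: frobX.
Qed.

Lemma dwork_opp : dwork p (fun n => - ghost p (Zvar r) n).
Proof.
move=> n; rewrite /frob_lift rmorphN /=.
by apply: congrnN; apply: frob_lift_ghost => // i; apply: frobX.
Qed.

Lemma mmap_Xvar x y k : mmap intr (pair_val x y) (Xvar r k) = x (inord k).
Proof. by rewrite mmapX mmap1U /pair_val (unsplitK (inl _)). Qed.

Lemma mmap_Yvar x y k : mmap intr (pair_val x y) (Yvar r k) = y (inord k).
Proof. by rewrite mmapX mmap1U /pair_val (unsplitK (inr _)). Qed.

Lemma mmap_Zvar x k : mmap intr x (Zvar r k) = x (inord k).
Proof. by rewrite mmapX mmap1U. Qed.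

Lemma wghost_unghost m (v : 'I_m -> A) T n : dwork p T -> (n < L)%N ->
  wghost (Witt p_pr [ffun k : 'I_L => mmap intr v (unghost p T k)]) n =
  mmap intr v (T n).
Proof.
move=> dT nL; rewrite -(ghost_unghost p_pr n dT) rmorph_ghost /=.
apply: eq_ghost => i ile; rewrite ffunE inordK //.
exact: leq_ltn_trans nL.
Qed.

Lemma wghostD x y n : (n < L)%N ->
  wghost (witt_add x y) n = wghost x n + wghost y n.
Proof.
move=> nL; have /= E := wghost_unghost (pair_val x y) dwork_add nL.
rewrite unlock E.
rewrite rmorphD.
by congr (_ + _); rewrite rmorph_ghost; apply: eq_ghost => i _ /=;
  rewrite ?mmap_Xvar ?mmap_Yvar.
Qed.

Lemma wghostM x y n : (n < L)%N ->
  wghost (witt_mul x y) n = wghost x n * wghost y n.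
Proof.
move=> nL; have /= E := wghost_unghost (pair_val x y) dwork_mul nL.
rewrite unlock E.
rewrite rmorphM.
by congr (_ * _); rewrite rmorph_ghost; apply: eq_ghost => i _ /=;
  rewrite ?mmap_Xvar ?mmap_Yvar.
Qed.

Lemma wghostN x n : (n < L)%N -> wghost (witt_opp x) n = - wghost x n.
Proof.
move=> nL; have /= E := wghost_unghost (x) dwork_opp nL.
rewrite unlock E.
rewrite rmorphN.
by congr (- _); rewrite rmorph_ghost; apply: eq_ghost => i _ /=; rewrite mmap_Zvar.
Qed.

Lemma wghost0 n : wghost (witt_zero A) n = 0.
Proof.
rewrite /wghost /ghost big1 // => i _.
by rewrite ffunE expr0n gtn_eqF ?mul0rn // expn_gt0 prime_gt0.
Qed.

Lemma wghost1 n : (n < L)%N -> wghost (witt_one A) n = 1.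
Proof.
move=> nL; rewrite /wghost /ghost big_ord_recl big1 => [|i _].
  rewrite ffunE /=; have -> : inord 0 = ord0 :> 'I_L by apply/val_inj; rewrite /= inordK.
  by rewrite eqxx expr1n addr0.
rewrite ffunE /= -val_eqE /= /bump inordK /= ?add1n; last first.
  exact: leq_ltn_trans nL.
by rewrite expr0n gtn_eqF ?mul0rn // expn_gt0 prime_gt0.
Qed.

End Ghost.

Lemma wghost_inj m (x y : W {mpoly int[m]}) :
  (forall n, (n < L)%N -> wghost x n = wghost y n) -> x = y.
Proof.
move=> xy; apply: wittP => k; rewrite -(inord_val k).
have : (k < L)%N by [].
elim/ltn_ind: (val k) => n IH nL.
have gE (z : W {mpoly int[m]}) : wghost z n =
    \sum_(i < n) z (inord i) ^+ (p ^ (n - i)) *+ (p ^ i) + z (inord n) *+ (p ^ n).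
  by rewrite /wghost /ghost big_ord_recr /= subnn expn0 expr1.
have := xy n nL; rewrite !gE.
rewrite (eq_bigr (fun i : 'I_n => y (inord i) ^+ (p ^ (n - i)) *+ (p ^ i))).
  move/addrI => E; apply/mpolyP => u; have := congr1 (mcoeff u) E.
  rewrite !mcoeffMn; apply: pmulrnI.
  by rewrite expn_gt0 prime_gt0.
by move=> i _; rewrite IH // (ltn_trans (ltn_ord i)).
Qed.

Definition wmap (A B : comNzRingType) (f : A -> B) (x : W A) : W B :=
  Witt p_pr [ffun k => f (x k)].

Lemma rmorph_mmap_int m (A B : comNzRingType) (f : {rmorphism A -> B})
    (v : 'I_m -> A) (g : {mpoly int[m]}) :
  f (mmap intr v g) = mmap intr (fun i => f (v i)) g.
Proof.
rewrite rmorph_sum; apply: eq_bigr => u _; rewrite rmorphM rmorph_int.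
rewrite rmorph_prod; congr (_ * _); apply: eq_bigr => i _.
by rewrite rmorphXn.
Qed.

Lemma eq_mmap_int m (A : comNzRingType) (v w : 'I_m -> A) (g : {mpoly int[m]}) :
  v =1 w -> mmap intr v g = mmap intr w g.
Proof.
move=> vw; apply: eq_bigr => u _; congr (_ * _).
by apply: eq_bigr => i _; rewrite vw.
Qed.

Section Naturality.

Variables (A B : comNzRingType) (f : {rmorphism A -> B}).

Lemma wmapD x y : wmap f (witt_add x y) = witt_add (wmap f x) (wmap f y).
Proof.
apply: wittP => k; rewrite ffunE !witt_addE rmorph_mmap_int; apply: eq_mmap_int => i.
by rewrite /pair_val; case: split => j; rewrite ffunE.
Qed.

Lemma wmapM x y : wmap f (witt_mul x y) = witt_mul (wmap f x) (wmap f y).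
Proof.
apply: wittP => k; rewrite ffunE !witt_mulE rmorph_mmap_int; apply: eq_mmap_int => i.
by rewrite /pair_val; case: split => j; rewrite ffunE.
Qed.

Lemma wmapN x : wmap f (witt_opp x) = witt_opp (wmap f x).
Proof.
apply: wittP => k; rewrite ffunE !witt_oppE rmorph_mmap_int; apply: eq_mmap_int => i.
by rewrite ffunE.
Qed.

Lemma wmap0 : wmap f (witt_zero A) = witt_zero B.
Proof. by apply: wittP => k; rewrite !ffunE rmorph0. Qed.

Lemma wmap1 : wmap f (witt_one A) = witt_one B.
Proof. by apply: wittP => k; rewrite !ffunE rmorph_nat. Qed.

End Naturality.

Section RingLaws.

Variable A : comNzRingType.
Implicit Types x y z : W A.

Lemma witt_lift x y z :
  exists m (f : {rmorphism {mpoly int[m]} -> A}) (x' y' z' : W {mpoly int[m]}),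
    [/\ x = wmap f x', y = wmap f y' & z = wmap f z'].
Proof.
pose v (i : 'I_(L + (L + L))) : A := match split i with
  | inl j => x j
  | inr j => match split j with inl k => y k | inr k => z k end end.
exists (L + (L + L))%N, (mmap intr v).
exists (Witt p_pr [ffun j : 'I_L => 'X_(lshift _ j)]).
exists (Witt p_pr [ffun j : 'I_L => 'X_(rshift L (lshift L j))]).
exists (Witt p_pr [ffun j : 'I_L => 'X_(rshift L (rshift L j))]).
split; apply: wittP => k; rewrite !ffunE /= mmapX mmap1U /v.
- by rewrite (unsplitK (inl _)).
- by rewrite (unsplitK (inr _)) (unsplitK (inl _)).
- by rewrite (unsplitK (inr _)) (unsplitK (inr _)).
Qed.

Lemma witt_addA : associative (@witt_add p p_pr r A).
Proof.
move=> x y z; have [m [f [x' [y' [z' [-> -> ->]]]]]] := witt_lift x y z.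
have /(congr1 (wmap f)) : witt_add x' (witt_add y' z') = witt_add (witt_add x' y') z'.
  apply: wghost_inj => n nL; rewrite !(wghostD _ _ nL).
  exact: addrA.
by rewrite !wmapD.
Qed.

Lemma witt_addC : commutative (@witt_add p p_pr r A).
Proof.
move=> x y; have [m [f [x' [y' [z' [-> -> _]]]]]] := witt_lift x y x.
have /(congr1 (wmap f)) : witt_add x' y' = witt_add y' x'.
  apply: wghost_inj => n nL; rewrite !(wghostD _ _ nL).
  exact: addrC.
by rewrite !wmapD.
Qed.

Lemma witt_add0 : left_id (witt_zero A) (@witt_add p p_pr r A).
Proof.
move=> x; have [m [f [x' [y' [z' [-> _ _]]]]]] := witt_lift x x x.
have /(congr1 (wmap f)) : witt_add (witt_zero _) x' = x'.
  apply: wghost_inj => n nL; rewrite (wghostD _ _ nL) wghost0.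
  exact: add0r.
by rewrite wmapD wmap0.
Qed.

Lemma witt_addN : left_inverse (witt_zero A) (@witt_opp p p_pr r A) (@witt_add p p_pr r A).
Proof.
move=> x; have [m [f [x' [y' [z' [-> _ _]]]]]] := witt_lift x x x.
have /(congr1 (wmap f)) : witt_add (witt_opp x') x' = witt_zero _.
  apply: wghost_inj => n nL; rewrite (wghostD _ _ nL) (wghostN _ nL) wghost0.
  exact: addNr.
by rewrite wmapD wmapN wmap0.
Qed.

Lemma witt_mulA : associative (@witt_mul p p_pr r A).
Proof.
move=> x y z; have [m [f [x' [y' [z' [-> -> ->]]]]]] := witt_lift x y z.
have /(congr1 (wmap f)) : witt_mul x' (witt_mul y' z') = witt_mul (witt_mul x' y') z'.
  apply: wghost_inj => n nL; rewrite !(wghostM _ _ nL).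
  exact: mulrA.
by rewrite !wmapM.
Qed.

Lemma witt_mulC : commutative (@witt_mul p p_pr r A).
Proof.
move=> x y; have [m [f [x' [y' [z' [-> -> _]]]]]] := witt_lift x y x.
have /(congr1 (wmap f)) : witt_mul x' y' = witt_mul y' x'.
  apply: wghost_inj => n nL; rewrite !(wghostM _ _ nL).
  exact: mulrC.
by rewrite !wmapM.
Qed.

Lemma witt_mul1 : left_id (witt_one A) (@witt_mul p p_pr r A).
Proof.
move=> x; have [m [f [x' [y' [z' [-> _ _]]]]]] := witt_lift x x x.
have /(congr1 (wmap f)) : witt_mul (witt_one _) x' = x'.
  apply: wghost_inj => n nL; rewrite (wghostM _ _ nL) (wghost1 _ nL).
  exact: mul1r.
by rewrite wmapM wmap1.
Qed.

Lemma witt_mulDl : left_distributive (@witt_mul p p_pr r A) (@witt_add p p_pr r A).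
Proof.
move=> x y z; have [m [f [x' [y' [z' [-> -> ->]]]]]] := witt_lift x y z.
have /(congr1 (wmap f)) : witt_mul (witt_add x' y') z' = witt_add (witt_mul x' z') (witt_mul y' z').
  apply: wghost_inj => n nL; rewrite !(wghostD _ _ nL, wghostM _ _ nL).
  exact: mulrDl.
by rewrite wmapD !wmapM wmapD.
Qed.

Lemma witt_one_neq0 : witt_one A != witt_zero A.
Proof.
apply/eqP => /(congr1 (fun x : W A => x ord0)) /eqP.
by rewrite /= !ffunE eqxx oner_eq0.
Qed.

HB.instance Definition _ := GRing.isZmodule.Build (W A)
  witt_addA witt_addC witt_add0 witt_addN.
HB.instance Definition _ := GRing.Zmodule_isComNzRing.Build (W A)
  witt_mulA witt_mulC witt_mul1 witt_mulDl witt_one_neq0.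

End RingLaws.

Section FinWitt.

Variable A : finComNzRingType.
Implicit Types x y : W A.

Definition witt_unit : {pred W A} := [pred x | [exists y : W A, y * x == 1]].
Definition witt_inv x : W A := odflt x [pick y : W A | y * x == 1].

Lemma witt_mulVx : {in witt_unit, left_inverse 1 witt_inv *%R}.
Proof.
move=> x /existsP[y yx]; rewrite /witt_inv; case: pickP => [z /eqP //|/(_ y)].
by rewrite yx.
Qed.

Lemma witt_unitP x y : y * x = 1 -> witt_unit x.
Proof. by move=> yx; apply/existsP; exists y; rewrite yx. Qed.

Lemma witt_inv_out : {in [predC witt_unit], witt_inv =1 id}.
Proof.
move=> x /existsPn nx; rewrite /witt_inv; case: pickP => // y yx.
by have := nx y; rewrite yx.
Qed.

HB.instance Definition _ := GRing.ComNzRing_hasMulInverse.Build (W A)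
  witt_mulVx witt_unitP witt_inv_out.

End FinWitt.
End WittRing.

(* The group algebra F[gT], as functions gT -> F with convolution; a record,
   for the same reason as witt. *)
Record group_algebra (F : Type) (gT : finGroupType) :=
  GroupAlgebra { gcoef :> {ffun gT -> F} }.

Section GroupAlgebra.

Variables (F : comNzRingType) (gT : finGroupType).
Local Notation FG := (group_algebra F gT).
Implicit Types (x y z : FG) (g h : gT) (a b : F).

HB.instance Definition _ := [isNew for @gcoef F gT].
HB.instance Definition _ := [Choice of FG by <:].

Lemma galgP x y : x =1 y -> x = y.
Proof. by case: x y => [x] [y] /= /ffunP ->. Qed.

Definition galg_add x y : FG := GroupAlgebra [ffun g => x g + y g].
Definition galg_opp x : FG := GroupAlgebra [ffun g => - x g].
Definition galg_zero : FG := GroupAlgebra [ffun=> 0].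
Definition galg_one : FG := GroupAlgebra [ffun g => (g == 1%g)%:R].
Definition galg_mul x y : FG :=
  GroupAlgebra [ffun g => \sum_(h : gT) x h * y (h^-1 * g)%g].
Definition galg_scale a x : FG := GroupAlgebra [ffun g => a * x g].

Lemma galg_addA : associative galg_add.
Proof. by move=> x y z; apply: galgP => g; rewrite !ffunE addrA. Qed.

Lemma galg_addC : commutative galg_add.
Proof. by move=> x y; apply: galgP => g; rewrite !ffunE addrC. Qed.

Lemma galg_add0 : left_id galg_zero galg_add.
Proof. by move=> x; apply: galgP => g; rewrite !ffunE add0r. Qed.

Lemma galg_addN : left_inverse galg_zero galg_opp galg_add.
Proof. by move=> x; apply: galgP => g; rewrite !ffunE addNr. Qed.

HB.instance Definition _ := GRing.isZmodule.Build FG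
  galg_addA galg_addC galg_add0 galg_addN.

Lemma galg_mulA : associative galg_mul.
Proof.
move=> x y z; apply: galgP => g; rewrite !ffunE.
under eq_bigr do rewrite ffunE big_distrr /=.
under [RHS]eq_bigr do rewrite ffunE big_distrl /=.
rewrite [RHS]exchange_big /=; apply: eq_bigr => h _.
rewrite [RHS](reindex_inj (mulgI h)) /=; apply: eq_bigr => k _.
by rewrite mulrA mulKg invMg mulgA.
Qed.

Lemma galg_mul1 : left_id galg_one galg_mul.
Proof.
move=> x; apply: galgP => g; rewrite !ffunE (bigD1 1%g) //= big1 => [|h].
  by rewrite ffunE eqxx mul1r invg1 mul1g addr0.
by rewrite ffunE => /negPf ->; rewrite mul0r.
Qed.

Lemma galg_mulr1 : right_id galg_one galg_mul.
Proof.
move=> x; apply: galgP => g; rewrite !ffunE (bigD1 g) //= big1 => [|h].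
  by rewrite ffunE mulVg eqxx mulr1 addr0.
rewrite ffunE => hg; case: eqP => [E|_]; last by rewrite mulr0.
by rewrite -(mulKVg h g) E mulg1 eqxx in hg.
Qed.

Lemma galg_mulDl : left_distributive galg_mul galg_add.
Proof.
move=> x y z; apply: galgP => g; rewrite !ffunE -big_split /=.
by apply: eq_bigr => h _; rewrite ffunE mulrDl.
Qed.

Lemma galg_mulDr : right_distributive galg_mul galg_add.
Proof.
move=> x y z; apply: galgP => g; rewrite !ffunE -big_split /=.
by apply: eq_bigr => h _; rewrite ffunE mulrDr.
Qed.

Lemma galg_one_neq0 : galg_one != 0.
Proof.
apply/eqP => /(congr1 (fun x : FG => x 1%g)) /eqP.
by rewrite /= !ffunE eqxx oner_eq0.
Qed.

HB.instance Definition _ := GRing.Zmodule_isNzRing.Build FG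
  galg_mulA galg_mul1 galg_mulr1 galg_mulDl galg_mulDr galg_one_neq0.

Lemma galg_scaleA a b x : galg_scale a (galg_scale b x) = galg_scale (a * b) x.
Proof. by apply: galgP => g; rewrite !ffunE mulrA. Qed.

Lemma galg_scale1 : left_id 1 galg_scale.
Proof. by move=> x; apply: galgP => g; rewrite !ffunE mul1r. Qed.

Lemma galg_scaleDr : right_distributive galg_scale +%R.
Proof. by move=> a x y; apply: galgP => g; rewrite !ffunE mulrDr. Qed.

Lemma galg_scaleDl x : {morph galg_scale^~ x : a b / a + b}.
Proof. by move=> a b; apply: galgP => g; rewrite !ffunE mulrDl. Qed.

HB.instance Definition _ := GRing.Zmodule_isLmodule.Build F FG
  galg_scaleA galg_scale1 galg_scaleDr galg_scaleDl.

Lemma galg_scaleAl a x y : a *: (x * y) = (a *: x) * y.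
Proof.
apply: galgP => g; rewrite !ffunE big_distrr /=; apply: eq_bigr => h _.
by rewrite ffunE mulrA.
Qed.

HB.instance Definition _ := GRing.Lmodule_isLalgebra.Build F FG galg_scaleAl.

Lemma galg_scaleAr a x y : a *: (x * y) = x * (a *: y).
Proof.
apply: galgP => g; rewrite !ffunE big_distrr /=; apply: eq_bigr => h _.
by rewrite ffunE mulrCA.
Qed.

HB.instance Definition _ := GRing.Lalgebra_isAlgebra.Build F FG galg_scaleAr.

End GroupAlgebra.

Section SpecialLinear.

Variables (n : nat) (R : finComUnitRingType).

Definition SLgroup : {set {'GL_n[R]}} := [set u | \det (GLval u) == 1].

Lemma SLgroup_group_set : group_set SLgroup.
Proof.
apply/group_setP; split=> [|u v]; rewrite !inE ?det1 // => /eqP du /eqP dv.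
by rewrite GL_ME det_mulmx du dv mulr1.
Qed.
Canonical SLgroup_group := Group SLgroup_group_set.

End SpecialLinear.

Variant GL_or_SL := GL | SL.

Definition points (G : GL_or_SL) (n : nat) (R : finComUnitRingType) :
    {group {'GL_n[R]}} :=
  match G with GL => GLgroup_group n R | SL => SLgroup_group n R end.

Definition perfect_field (F : fieldType) : Prop :=
  forall p, p \in [pchar F] -> forall x : F, exists y : F, x = y ^+ p.

Definition alg_isomorphic (F : comNzRingType) (A B : algType F) : Prop :=
  exists f : {lrmorphism A -> B}, bijective f.

(* Main.v *)
Require Import Defs.
From HB Require Import structures.
From mathcomp.multinomials Require Import mpoly.
From mathcomp Require Import all_boot all_order all_algebra all_fingroup.
From mathcomp Require Import all_solvable all_field ring zify.

Set Implicit Arguments.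
Unset Strict Implicit.
Unset Printing Implicit Defensive.

Import Order.TTheory GRing.Theory Num.Theory.
Local Open Scope ring_scope.

(** The two group algebras are told apart by the exponent of the p-elements.

    Over a perfect field F of characteristic p, the algebra F[G] determines
    the least k such that g^(p^k) = 1 for every p-element g of G
    ([p_exponent_of_group_algebra]).  The reason is that the Frobenius map is
    additive up to commutators ([trace_Frobenius]): for a trace form lam, that
    is, the linear extension of a class function, lam (x^(p^j)) is a p^j-th
    power of the value at x of another trace form, given by the p^j-th power
    map of the group ([class_form_Frobenius]).  If the p-elements of H are
    killed by p^k, then the power maps of exponents p^k and p^m coincide on H
    for suitable large m, so a nilpotent y in F[H] satisfies
    lam (y^(p^k)) = 0 for all trace forms lam.  In F[G], on the other hand, the
    element x = g - 1 attached to a p-element g is nilpotent, and the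
    coefficient of x^(p^k) = g^(p^k) - 1 at 1 is -1 unless g^(p^k) = 1.

    Over F_q[t]/t^r, a p-element is 1 + N with N nilpotent; then N^n is
    divisible by t, hence N^(nr) = 0 and 1 + N is killed by every p^k >= nr
    ([GL_qpoly_p_exponent]).  Over W_r(F_q) the p-elements live longer, because
    p^j <> 0 for j < r ([witt_mulpX_top]).  For n >= 2 an elementary matrix has
    order p^r ([elementary_order]), whereas p^(r-1) >= nr.  For n = 1 the units
    1 + p^d y, of order p^(r-d), do the job ([witt_unit_order]): d = 1 for p
    odd, and d = 2 for p = 2, where a square root of 1 + 4y gains one more
    factor 2 as soon as q > 2. *)

(** * Frobenius and traces *)

(** The orbits of s have 1 or p elements, and v is constant on each of them. *)
Lemma sum_perm_fixed (p : nat) (V : zmodType) (T : finType) (s : {perm T})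
    (v : T -> V) :
  prime p -> (forall w : V, w *+ p = 0) -> (s ^+ p = 1)%g ->
  (forall x, v (s x) = v x) ->
  \sum_x v x = \sum_(x | s x == x) v x.
Proof.
move=> p_pr pV sp vs; rewrite (bigID (fun x => s x == x)) /=.
rewrite [X in _ + X](_ : _ = 0) ?addr0 //.
pose D := [set x | s x != x].
have actsD : [acts <[s]>, on D | 'P]%g.
  apply/subsetP=> t /cycleP[i ->]; rewrite !inE /=.
  apply/subsetP=> x; rewrite !inE /= /aperm.
  by rewrite -permM -expgSr expgS permM (inj_eq perm_inj).
have vG x y : y \in orbit 'P <[s]>%g x -> v y = v x.
  case/orbitP=> _ /cycleP[i ->] <-; rewrite /= /aperm.
  by elim: i => [|i IH]; rewrite ?expg0 ?perm1 // expgSr permM vs.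
rewrite (eq_bigl (fun x => x \in D)) => [|x]; last by rewrite inE.
rewrite (set_partition_big _ (orbit_partition actsD)) /=.
apply: big1 => O /imsetP[x xD ->].
rewrite (eq_bigr (fun=> v x)) => [|y /vG //].
have nt : #|orbit 'P <[s]>%g x| != 1%N.
  apply/eqP => /card_orbit1 E; move: xD; rewrite inE => /eqP; apply.
  by apply/set1P; rewrite -E; apply/orbitP; exists s; rewrite ?cycle_id.
rewrite sumr_const; have -> // : #|orbit 'P <[s]>%g x| = p.
apply/prime_nt_dvdP => //; apply: dvdn_trans (_ : #[s]%g %| p)%N.
  by rewrite card_orbit dvdn_indexg.
by rewrite order_dvdn sp.
Qed.

Definition ffun_rot (I : finType) m (f : {ffun 'I_m -> I}) : {ffun 'I_m -> I} :=
  [ffun j => f (ordS j)].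

Lemma ffun_rot_inj (I : finType) m : injective (@ffun_rot I m).
Proof.
move=> f g /ffunP fg; apply/ffunP => j.
by have := fg (ord_pred j); rewrite !ffunE ord_predK.
Qed.

Lemma iter_ffun_rot (I : finType) m (f : {ffun 'I_m -> I}) k j :
  iter k (@ffun_rot I m) f j = f (iter k (@ordS m) j).
Proof.
by elim: k j => // k IH j; rewrite iterS ffunE IH -iterSr.
Qed.

Lemma val_iter_ordS m k (j : 'I_m) : iter k (@ordS m) j = ((j + k) %% m)%N :> nat.
Proof.
elim: k => [|k IH]; first by rewrite addn0 modn_small.
by rewrite iterS /= IH -addn1 modnDml addn1 addnS.
Qed.

(** Expanding the power gives one term for each word of length p in the a i.
    The trace is unchanged by a cyclic rotation of the word, so the words that
    are not constant cancel p by p. *)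
Lemma trace_Frobenius (p : nat) (A : nzRingType) (V : zmodType)
    (lam : {additive A -> V}) (I : finType) (a : I -> A) :
  prime p -> (forall w : V, w *+ p = 0) ->
  (forall x y, lam (x * y) = lam (y * x)) ->
  lam ((\sum_i a i) ^+ p) = \sum_i lam (a i ^+ p).
Proof.
move=> p_pr pV lamC.
pose v (f : {ffun 'I_p -> I}) := lam (\prod_j a (f j)).
have -> : lam ((\sum_i a i) ^+ p) = \sum_f v f.
  rewrite -[p in LHS]card_ord -prodr_const bigA_distr_bigA raddf_sum.
  by apply: eq_bigr => f _.
pose s := perm (@ffun_rot_inj I p).
have sE k f : (s ^+ k)%g f = iter k (@ffun_rot I p) f.
  by rewrite permX; apply: eq_iter => g; rewrite permE.
rewrite (@sum_perm_fixed p _ _ s) // => [||f]; last 1 first.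
- rewrite /v permE /ffun_rot; case: p p_pr f {pV v s sE} => [//|m] _ f.
  rewrite big_ord_recr big_ord_recl /= lamC !ffunE; congr (lam (a (f _) * _)).
    by apply: val_inj; rewrite /= modnn.
  apply: eq_bigr => j _; rewrite ffunE; congr (a (f _)); apply: val_inj.
  by rewrite /= modn_small ?ltnS.
- rewrite (reindex_onto (fun i => [ffun=> i]) (fun f => f (Ordinal (prime_gt0 p_pr)))).
    apply: eq_big => [i|i _].
      rewrite ffunE eqxx andbT permE; apply/eqP/ffunP => j.
      by rewrite !ffunE.
    rewrite /v (eq_bigr (fun=> a i)) => [|j _]; last by rewrite ffunE.
    by rewrite prodr_const card_ord.
  move=> f /eqP sf; apply/ffunP => j; rewrite ffunE.
  have : (s ^+ j)%g f = f.
    by elim: (val j) => [|k IH]; rewrite ?expg0 ?perm1 // expgSr permM IH.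
  move=> /ffunP /(_ (Ordinal (prime_gt0 p_pr))); rewrite sE iter_ffun_rot.
  move=> <-; congr (f _); apply: ord_inj.
  by rewrite val_iter_ordS /= add0n modn_small.
- apply/permP => f; rewrite sE perm1; apply/ffunP => j.
  rewrite iter_ffun_rot; congr (f _); apply: ord_inj.
  by rewrite val_iter_ordS modnDr modn_small.
Qed.

(** * The p-exponent of a group is determined by its group algebra *)

Lemma expr_subr1_pchar (p : nat) (R : nzRingType) (x : R) j :
  p \in [pchar R] -> (x - 1) ^+ (p ^ j) = x ^+ (p ^ j) - 1.
Proof.
move=> pcharR; elim: j => [|j IH]; first by rewrite !expr1.
rewrite expnSr !exprM IH -!(pFrobenius_autE pcharR).
by rewrite pFrobenius_autB_comm ?pFrobenius_aut1 //; apply: commr1.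
Qed.

Section GroupAlgebraTrace.

Variables (F : comNzRingType) (gT : finGroupType).
Implicit Types (g h : gT) (x y : group_algebra F gT) (c : gT -> F).

Definition galg_delta g : group_algebra F gT :=
  GroupAlgebra [ffun h => (h == g)%:R].

Lemma galg_delta1 : galg_delta 1 = 1.
Proof. by []. Qed.

Lemma galg_deltaM g h : galg_delta (g * h) = galg_delta g * galg_delta h.
Proof.
apply: galgP => k; rewrite !ffunE (bigD1 g) //= big1 => [|l lg].
  by rewrite !ffunE eqxx mul1r addr0 (canF_eq (mulKVg g)).
by rewrite ffunE (negPf lg) mul0r.
Qed.

Lemma galg_deltaX g m : galg_delta (g ^+ m) = galg_delta g ^+ m.
Proof. by elim: m => // m IH; rewrite expgS exprS galg_deltaM IH. Qed.

Lemma galg_sumE (I : Type) (s : seq I) (P : pred I) (f : I -> group_algebra F gT) h :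
  (\sum_(i <- s | P i) f i) h = \sum_(i <- s | P i) f i h.
Proof. by elim/big_rec2: _ => [|i _ y _ <-]; rewrite ffunE. Qed.

Lemma galg_sum_delta x : x = \sum_g x g *: galg_delta g.
Proof.
apply: galgP => h; rewrite galg_sumE (bigD1 h) //= big1 => [|g gh].
  by rewrite !ffunE eqxx mulr1 addr0.
by rewrite !ffunE eq_sym (negPf gh) mulr0.
Qed.

(** The linear extension of c to the group algebra; it is a trace form when c
    is a class function, and all trace forms are of this kind. *)
Definition class_form c x : F := \sum_g x g * c g.

Lemma class_form_zmod c : zmod_morphism (class_form c).
Proof.
move=> x y; rewrite /class_form -sumrB; apply: eq_bigr => g _.
by rewrite !ffunE mulrBl.
Qed.
HB.instance Definition _ c :=
  GRing.isZmodMorphism.Build (group_algebra F gT) F (class_form c)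
    (class_form_zmod c).

Lemma class_form_delta c a g : class_form c (a *: galg_delta g) = a * c g.
Proof.
rewrite /class_form (bigD1 g) //= big1 => [|h hg].
  by rewrite !ffunE eqxx mulr1 addr0.
by rewrite !ffunE (negPf hg) mulr0 mul0r.
Qed.

Lemma class_formC c : (forall g h, c (g * h)%g = c (h * g)%g) ->
  forall x y, class_form c (x * y) = class_form c (y * x).
Proof.
move=> cC x y; rewrite (galg_sum_delta x) (galg_sum_delta y).
rewrite !mulr_suml !raddf_sum; under eq_bigr do rewrite mulr_sumr raddf_sum.
rewrite exchange_big; apply: eq_bigr => h _; rewrite mulr_sumr raddf_sum.
apply: eq_bigr => g _.
rewrite -!scalerAl -!scalerAr !scalerA -!galg_deltaM /= !class_form_delta.
by rewrite cC [y h * _]mulrC.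
Qed.

Lemma galg_coef1C x y : (x * y) 1%g = (y * x) 1%g.
Proof.
rewrite !ffunE (reindex_inj invg_inj); apply: eq_bigr => g _.
by rewrite invgK !mulg1 mulrC.
Qed.

Variable p : nat.
Hypothesis pcharF : p \in [pchar F].

(** The class function is raised to the power p^j as well so that both sides
    become p^j-th powers; any class function over a perfect field is of this
    form. *)
Lemma class_form_Frobenius c x j :
  (forall g h, c (g * h)%g = c (h * g)%g) ->
  class_form (fun g => c g ^+ (p ^ j)) (x ^+ (p ^ j)) =
    class_form (fun g => c (g ^+ (p ^ j))%g) x ^+ (p ^ j).
Proof.
have p_pr := pcharf_prime pcharF.
have step c' x' : (forall g h, c' (g * h)%g = c' (h * g)%g) ->
    class_form (fun g => c' g ^+ p) (x' ^+ p) =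
    class_form (fun g => c' (g ^+ p)%g) x' ^+ p.
  move=> cC; rewrite {1}(galg_sum_delta x') trace_Frobenius //; last first.
  - by apply: class_formC => g h; rewrite cC.
  - by move=> a; rewrite -mulr_natr (pcharf0 pcharF) mulr0.
  rewrite -!(pFrobenius_autE pcharF) rmorph_sum; apply: eq_bigr => g _ /=.
  by rewrite pFrobenius_autE exprZn -galg_deltaX class_form_delta exprMn.
elim: j c => [|j IH] c cC.
  by rewrite !expr1; apply: eq_bigr => g _; rewrite expr1 expg1.
have -> : class_form (fun g => c g ^+ (p ^ j.+1)) (x ^+ (p ^ j.+1)) =
    class_form (fun g => (c g ^+ (p ^ j)) ^+ p) ((x ^+ (p ^ j)) ^+ p).
  by rewrite -exprM -expnSr; apply: eq_bigr => g _; rewrite -exprM -expnSr.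
rewrite step => [|g h]; last by rewrite cC.
rewrite (IH (fun g => c (g ^+ p)%g)) => [|g h].
  rewrite -exprM -expnSr; congr (_ ^+ _); apply: eq_bigr => g _.
  by rewrite -expgM -expnSr.
have conjC u v : c (u ^ v)%g = c u by rewrite /conjg cC mulgK.
(* The p-th power map sends conjugate elements to conjugate elements. *)
have -> : (g * h)%g = ((h * g) ^ h)%g by rewrite /conjg mulgA mulKg.
by rewrite -conjXg conjC.
Qed.

End GroupAlgebraTrace.

(** Write #|gT| = p^s M with M prime to p.  The powers g^(p^k) have order
    dividing M, so it suffices that p^(m - k) = 1 modulo M. *)
Lemma expg_pow_stable (gT : finGroupType) (p k b : nat) : prime p ->
  (forall (g : gT) m, (g ^+ (p ^ m) = 1)%g -> (g ^+ (p ^ k) = 1)%g) ->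
  exists2 m, (b <= m)%N & forall g : gT, (g ^+ (p ^ m) = g ^+ (p ^ k))%g.
Proof.
move=> p_pr pk; pose N := #|[set: gT]|; pose M := (N`_p^')%N.
have coM : coprime p M by rewrite prime_coprime // -p'natE // part_pnat.
pose a := (totient M * b)%N.
have M_gt0 : (0 < M)%N by rewrite part_gt0.
exists (k + a)%N => [|g].
  by rewrite (leq_trans _ (leq_addl _ _)) // leq_pmull // totient_gt0.
have gM : ((g ^+ (p ^ k)) ^+ M = 1)%g.
  rewrite -expgM mulnC expgM; apply: (pk _ (logn p N)); rewrite -expgM mulnC.
  by rewrite -p_part partnC ?cardG_gt0 // expg_cardG ?inE.
rewrite expnD expgM -(expg_mod _ gM) expnM.
have Ep : (p ^ totient M = 1 %[mod M])%N by apply: Euler_exp_totient.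
by rewrite -modnXm Ep modnXm exp1n (expg_mod _ gM) expg1.
Qed.

Lemma p_exponent_of_group_algebra (p k : nat) (F : fieldType)
    (gT hT : finGroupType) :
  p \in [pchar F] -> perfect_field F ->
  alg_isomorphic (group_algebra F gT) (group_algebra F hT) ->
  (forall (h : hT) m, (h ^+ (p ^ m) = 1)%g -> (h ^+ (p ^ k) = 1)%g) ->
  forall (g : gT) m, (g ^+ (p ^ m) = 1)%g -> (g ^+ (p ^ k) = 1)%g.
Proof.
move=> pcharF perfF [f [f' fK f'K]] hk g b gb.
have p_pr := pcharf_prime pcharF.
have Frob_inj j : injective (fun a : F => a ^+ (p ^ j)).
  elim: j => [|j IH] a a'; rewrite ?expr1 // expnSr !exprM => E.
  by apply: IH; apply: (fmorph_inj (pFrobenius_aut pcharF)).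
have root j (a : F) : exists a', a' ^+ (p ^ j) == a.
  elim: j a => [|j IH] a; first by exists a; rewrite expr1.
  have [a1 ->] := perfF p pcharF a; have [a2 /eqP <-] := IH a1.
  by exists a2; rewrite -exprM expnSr.
have [m bm hm] := expg_pow_stable b p_pr hk.
have f'M : monoid_morphism f' by apply: can2_monoid_morphism fK f'K.
(* c is the class function of the trace form on F[hT] that corresponds under f
   to the coefficient at 1 on F[gT], see formE. *)
pose c h := f' (galg_delta F h) 1%g.
have formE z : class_form c (f z) = z 1%g.
  rewrite -[in RHS](fK z) (galg_sum_delta (f z)).
  have -> : f' (\sum_h f z h *: galg_delta F h) =
      \sum_h f z h *: f' (galg_delta F h).
    apply: (can_inj fK); rewrite f'K linear_sum; apply: eq_bigr => h _.
    by rewrite linearZ /= f'K.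
  rewrite -galg_sum_delta galg_sumE; apply: eq_bigr => h _.
  by rewrite /c ffunE.
(* d inherits from c that it is a class function, p^k-th roots being unique. *)
pose d h := xchoose (root k (c h)).
have dE h : d h ^+ (p ^ k) = c h by apply/eqP/(xchooseP (root k (c h))).
have dC h h' : d (h * h')%g = d (h' * h)%g.
  by apply: (Frob_inj k); rewrite /= !dE /c !galg_deltaM !f'M.2 galg_coef1C.
have pcharFG : p \in [pchar (group_algebra F gT)].
  apply/andP; split=> //; apply/eqP/galgP => h.
  by rewrite -scaler_nat !ffunE (pcharf0 pcharF) mul0r.
pose x := galg_delta F g - 1.
have xX j : x ^+ (p ^ j) = galg_delta F (g ^+ (p ^ j))%g - 1.
  by rewrite expr_subr1_pchar // galg_deltaX.
have fx0 : (f x) ^+ (p ^ m) = 0.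
  by rewrite -rmorphXn xX -(subnKC bm) expnD expgM gb expg1n galg_delta1 subrr raddf0.
have : class_form c ((f x) ^+ (p ^ k)) = 0.
  have -> : class_form c (f x ^+ (p ^ k)) =
            class_form (fun h => d h ^+ (p ^ k)) (f x ^+ (p ^ k)).
    by apply: eq_bigr => h _; rewrite dE.
  rewrite (class_form_Frobenius pcharF) //.
  have -> : class_form (fun h => d (h ^+ (p ^ k))%g) (f x) =
            class_form (fun h => d (h ^+ (p ^ m))%g) (f x).
    by apply: eq_bigr => h _; rewrite hm.
  have /eqP := class_form_Frobenius pcharF (f x) m dC.
  rewrite fx0 raddf0 eq_sym expf_eq0 => /andP[_ /eqP ->].
  by rewrite expr0n gtn_eqF // expn_gt0 prime_gt0.
rewrite -rmorphXn formE xX !ffunE eqxx => /eqP.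
by rewrite subr_eq0 eq_sym; case: (1%g =P _) => // _; rewrite oner_eq0.
Qed.

(** * Multiples of p^j in the Witt vectors *)

Lemma mpoly_int_mulrnI m d : (0 < d)%N ->
  injective (fun f : {mpoly int[m]} => f *+ d).
Proof.
move=> d_gt0 f g /= fg; apply/mpolyP => u; have := congr1 (mcoeff u) fg.
by rewrite !mcoeffMn; apply: pmulrnI.
Qed.

Section WittMultiples.

Variables (p : nat) (p_pr : prime p) (r : nat).
Local Notation L := r.-1.+1.
Local Notation W := (witt p_pr r).

Lemma wmapMn (A B : comNzRingType) (f : {rmorphism A -> B}) (x : W A) k :
  wmap f (x *+ k) = wmap f x *+ k.
Proof. by elim: k => [|k IH]; rewrite ?wmap0 // !mulrS [LHS]wmapD IH. Qed.

Lemma wghostMn (A : comNzRingType) (x : W A) k n : (n < L)%N ->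
  wghost (x *+ k) n = wghost x n *+ k.
Proof.
move=> nL; elim: k => [|k IH]; first exact: wghost0.
by rewrite !mulrS [LHS]wghostD // IH.
Qed.

(** Over a ring without p-torsion, p^j x is determined by its ghost components
    p^j w_n(x), where w_n(x) = x_0^(p^n) modulo p.  By induction on n, the n-th
    coordinate u_n is divisible by p^(j - n), so that the terms
    p^i u_i^(p^(n - i)) with i < n of w_n(p^j x) are divisible by p^(j + 1),
    and u_n can be read off modulo p^(j - n + 1). *)
Lemma witt_mpoly_mulpX m (x : W {mpoly int[m]}) j n :
  (n <= j)%N -> (j < L)%N -> exists c,
    (x *+ (p ^ j)) (inord n) = (x ord0 ^+ (p ^ n) + p%:R * c) *+ (p ^ (j - n)).
Proof.
move=> nj jL; elim/ltn_ind: n nj => n IH nj; have p_gt0 := prime_gt0 p_pr.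
have nL : (n < L)%N by apply: leq_ltn_trans jL.
have [c1 wx] : congr_modn p (wghost x n) (x ord0 ^+ (p ^ n)).
  rewrite /wghost /ghost big_ord_recl subn0 expn0 mulr1n.
  rewrite (_ : inord _ = ord0); last by apply: val_inj; rewrite /= inordK.
  rewrite -[X in congr_modn _ _ X]addr0; apply: congrnD; first exact: congrn_refl.
  elim/big_ind: _ => [|a b ca cb|i _]; first exact: congrn_refl.
    by rewrite -[0]addr0; apply: congrnD.
  exists (x (inord (lift ord0 i)) ^+ (p ^ (n - lift ord0 i)) *+ (p ^ i)).
  by rewrite add0r mulr_natl -mulrnA -expnSr.
have [c2 su] : congr_modn (p ^ j.+1)
    (\sum_(i < n) (x *+ (p ^ j)) (inord i) ^+ (p ^ (n - i)) *+ (p ^ i)) 0.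
  elim/big_ind: _ => [|a b ca cb|i _]; first exact: congrn_refl.
    by rewrite -[0]addr0; apply: congrnD.
  have ij : (i < j)%N by apply: leq_trans nj.
  have [c ->] := IH i (ltn_ord i) (ltnW ij).
  set e := _ + _; apply: (@congrn_dvd _ (p ^ (i + (j - i) * p ^ (n - i)))).
    apply: dvdn_exp2l; rewrite -[in X in (X <= _)%N](subnKC (ltnW ij)) -addnS leq_add2l.
    have p1 : (1 < p ^ (n - i))%N by rewrite -{1}(expn0 p) ltn_exp2l ?prime_gt1 // subn_gt0.
    by rewrite -{1}[(j - i)%N]muln1 ltn_pmul2l // subn_gt0.
  exists (e ^+ (p ^ (n - i))).
  rewrite add0r exprMn_n -mulrnA -expnM mulr_natl; congr (_ *+ _).
  by rewrite expnD mulnC.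
have := wghostMn x (p ^ j) nL; rewrite /wghost {1}/ghost big_ord_recr /= su.
rewrite subnn expn0 expr1 add0r => E.
exists (c1 - c2); apply: (mpoly_int_mulrnI (_ : 0 < p ^ n)%N); rewrite ?expn_gt0 ?p_gt0 //=.
rewrite -mulrnA -expnD subnK //; apply: (addrI ((p ^ j.+1)%:R * c2)); rewrite E.
rewrite -/(wghost x n) wx expnS -[LHS]mulr_natl -[X in _ = _ + X]mulr_natl natrM.
ring.
Qed.

(** Transfer of the previous lemma, for n = j, along a map from a polynomial
    ring over the integers.  In particular p^j x is nonzero over a field of
    characteristic p when x_0 is. *)
Lemma witt_mulpX_top (A : comNzRingType) (x : W A) j :
  p \in [pchar A] -> (j < L)%N -> (x *+ (p ^ j)) (inord j) = x ord0 ^+ (p ^ j).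
Proof.
move=> pcharA jL; have [m [f [x' [_ [_ [-> _ _]]]]]] := witt_lift x x x.
have [c E] := witt_mpoly_mulpX x' (leqnn j) jL.
rewrite -wmapMn ffunE E subnn expn0 mulr1n rmorphD rmorphM rmorph_nat.
by rewrite (pcharf0 pcharA) mul0r addr0 ffunE rmorphXn.
Qed.

Lemma card_witt (A : finType) : #|{: W A}| = (#|A| ^ L)%N.
Proof.
rewrite -[in RHS](card_ord L) -card_ffun.
by apply: (bij_eq_card (f := @wcoord p p_pr r A)); exists (@Witt p p_pr r A) => [[]|].
Qed.

(** Translation by 1 permutes the ring, so the sum of all its elements is
    unchanged when its cardinal, a power of p, is added. *)
Lemma witt_nat_pX_eq0 (A : finComNzRingType) e : #|A| = (p ^ e)%N ->
  exists s, (p ^ s)%:R = 0 :> W A.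
Proof.
move=> cardA; exists (e * L)%N; rewrite expnM -cardA -card_witt.
have /eqP : \sum_(x : W A) x = \sum_(x : W A) (1 + x).
  by rewrite [LHS](reindex_inj (addrI (1 : W A))).
rewrite big_split /= eq_sym -subr_eq0 addrK => /eqP <-.
by rewrite sumr_const.
Qed.

Lemma witt0_add (A : comNzRingType) (x y : W A) : (x + y) ord0 = x ord0 + y ord0.
Proof.
have := wghostD x y (ltn0Sn r.-1); rewrite /wghost /ghost !big_ord1 !expn0 !expr1 !mulr1n.
by rewrite (_ : inord 0 = ord0) //; apply: val_inj; rewrite /= inordK.
Qed.

Lemma witt0_mul (A : comNzRingType) (x y : W A) : (x * y) ord0 = x ord0 * y ord0.
Proof.
have := wghostM x y (ltn0Sn r.-1); rewrite /wghost /ghost !big_ord1 !expn0 !expr1 !mulr1n.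
by rewrite (_ : inord 0 = ord0) //; apply: val_inj; rewrite /= inordK.
Qed.

End WittMultiples.

(** * The p-elements over truncated polynomials *)

(** The minimal polynomial divides X^m, so it is X^k up to a constant, and its
    degree is at most the dimension. *)
Lemma expmx_dim_eq0 (F : fieldType) n (A : 'M[F]_n.+1) m :
  A ^+ m = 0 -> A ^+ n.+1 = 0.
Proof.
move=> Am; have hX k : horner_mx A ('X ^+ k) = A ^+ k by rewrite rmorphXn /= horner_mx_X.
have : mxminpoly A %| ('X - 0%:P) ^+ m.
  by rewrite subr0; apply: mxminpoly_min; rewrite hX.
case/dvdp_exp_XsubCP => k _; rewrite subr0 => Ek.
have : mxminpoly A %| 'X^(n.+1).
  rewrite (eqp_dvdl _ Ek); apply: dvdp_exp2l.
  have := dvdp_leq (monic_neq0 (char_poly_monic A)) (mxminpoly_dvd_char A).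
  by rewrite size_char_poly (eqp_size Ek) size_polyXn.
by move/mxminpoly_minP; rewrite hX.
Qed.

Section TruncatedPolynomials.

Variables (F : fieldType) (r n : nat).
Hypothesis r_gt0 : (0 < r)%N.
Local Notation Q := {poly %/ ('X^r : {poly F})}.

Let monicXr : mk_monic ('X^r : {poly F}) = 'X^r.
Proof. by rewrite mk_monic_Xn prednK. Qed.

Lemma in_qpoly_Xn_eq0 (f : {poly F}) : in_qpoly 'X^r f = 0 -> f.[0] = 0.
Proof.
move=> /(congr1 val) /= f0; have : 'X^r %| f by rewrite Pdiv.Idomain.dvdpE /Pdiv.Ring.rdvdp -monicXr f0.
case/dvdpP => g ->.
by rewrite hornerM hornerXn expr0n gtn_eqF // mulr0.
Qed.

Lemma in_qpoly_Xn : in_qpoly 'X^r 'X^r = 0 :> Q.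
Proof.
apply: val_inj => /=; rewrite monicXr.
by apply: Pdiv.RingMonic.rmodpp; apply: monicXn.
Qed.

Lemma horner0_eq0 (f : {poly F}) : f.[0] = 0 -> exists g, f = 'X * g.
Proof.
by move=> /polyXsubCP; rewrite subr0 => /dvdpP[g ->]; exists g; rewrite mulrC.
Qed.

(** Modulo t the matrix N is nilpotent over a field, so its power of exponent
    the dimension is divisible by t.  The argument is carried out on a lift N'
    of N to polynomials. *)
Lemma expmx_qpoly_eq0 (N : 'M[Q]_n.+1) m : N ^+ m = 0 -> N ^+ (n.+1 * r) = 0.
Proof.
pose N' : 'M[{poly F}]_n.+1 := map_mx (@polyn _ _) N.
have NE k : N ^+ k = map_mx (in_qpoly 'X^r) (N' ^+ k).
  rewrite rmorphXn /=; congr (_ ^+ _); apply/matrixP => i j; rewrite !mxE.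
  by apply: val_inj => /=; rewrite Pdiv.Ring.rmodp_small // size_mk_monic.
move=> Nm; have Nm0 : (map_mx (horner_eval 0) N') ^+ m = 0.
  rewrite -rmorphXn; apply/matrixP => i j; rewrite !mxE.
  apply: in_qpoly_Xn_eq0; have /matrixP/(_ i j) := Nm.
  by rewrite NE !mxE.
have [B NB] : exists B : 'M[{poly F}]_n.+1, N' ^+ n.+1 = 'X *: B.
  have cE i j : exists g, (N' ^+ n.+1) i j == 'X * g.
    have [|g ->] := @horner0_eq0 ((N' ^+ n.+1) i j); last by exists g.
    have /matrixP/(_ i j) := expmx_dim_eq0 Nm0.
    by rewrite -rmorphXn !mxE.
  exists (\matrix_(i, j) xchoose (cE i j)); apply/matrixP => i j.
  by rewrite !mxE; apply/eqP/(xchooseP (cE i j)).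
rewrite NE exprM NB exprZn; apply/matrixP => i j.
by rewrite !mxE rmorphM /= in_qpoly_Xn mul0r.
Qed.

(** Here (A - 1)^(p^j) = A^(p^j) - 1, by the characteristic. *)
Lemma GL_qpoly_p_exponent (p k : nat) (A : 'M[Q]_n.+1) m :
  p \in [pchar F] -> (n.+1 * r <= p ^ k)%N ->
  A ^+ (p ^ m) = 1 -> A ^+ (p ^ k) = 1.
Proof.
move=> pcharF le_nr Am.
have pcharM : p \in [pchar 'M[Q]_n.+1].
  rewrite inE (pcharf_prime pcharF) /=; apply/eqP.
  rewrite -(rmorph_nat (@scalar_mx Q n.+1)) -(rmorph_nat (in_qpoly 'X^r)).
  by rewrite -polyC_natr (pcharf0 pcharF) !rmorph0.
have N0 : (A - 1) ^+ (p ^ m) = 0 by rewrite expr_subr1_pchar // Am subrr.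
apply/eqP; rewrite -subr_eq0 -expr_subr1_pchar //.
by rewrite -(subnKC le_nr) exprD (expmx_qpoly_eq0 N0) mul0r.
Qed.

End TruncatedPolynomials.

(** * Elements of large order over the Witt vectors *)

(** One p-th power raises the exponent of p by exactly one, because in
    (1 + z)^p = 1 + p z + C(p, 2) z^2 + d z^3, with z = p^e y, the terms after
    p z are divisible by p^(e + 2).  For p = 2 the binomial coefficient is not
    divisible by p, which is made up for by z^2 when e > 1. *)
Lemma exp_one_addpX (R : comNzRingType) (p e : nat) (y : R) i : prime p ->
  (0 < e)%N -> (2 < p)%N \/ (1 < e)%N ->
  exists c, (1 + (p ^ e)%:R * y) ^+ (p ^ i) = 1 + (p ^ (e + i))%:R * (y + p%:R * c).
Proof.
move=> p_pr e_gt0 pe.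
have step e' (y' : R) : (0 < e')%N -> (2 < p)%N \/ (1 < e')%N ->
    exists c, (1 + (p ^ e')%:R * y') ^+ p = 1 + (p ^ e'.+1)%:R * (y' + p%:R * c).
  move=> {}e_gt0 {}pe; set z := _ * y'.
  have exp3 n : exists d, (1 + z) ^+ n = 1 + n%:R * z + 'C(n, 2)%:R * z ^+ 2 + d * z ^+ 3.
    elim: n => [|n [d dE]]; first by exists 0; rewrite expr0 bin_small //; ring.
    exists (d + 'C(n, 2)%:R + d * z); rewrite exprS dE binS bin1 natrD -natr1; ring.
  have [p2|p2] := ltnP 2 p.
    have [d ->] := exp3 p.
    have /dvdnP[a ->] : (p %| 'C(p, 2))%N by apply: prime_dvd_bin.
    have [f eE] : exists f, e' = f.+1 by exists e'.-1; rewrite prednK.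
    exists (a%:R * (p ^ f)%:R * y' ^+ 2 + d * (p ^ f)%:R ^+ 2 * y' ^+ 3).
    by rewrite /z eE !expnS !natrM; ring.
  have {p2}p2 : p = 2%N by apply/eqP; rewrite eqn_leq p2 prime_gt1.
  case: pe => [|e2]; first by rewrite p2.
  have [f eE] : exists f, e' = f.+2 by exists e'.-2; lia.
  by exists ((2 ^ f)%:R * y' ^+ 2); rewrite /z eE p2 !expnS !natrM; ring.
elim: i => [|i [c IH]]; first by exists 0; rewrite addn0 mulr0 addr0.
have [||c' E] := step (e + i)%N (y + p%:R * c); [lia | lia |].
by exists (c + c'); rewrite expnSr exprM IH E addnS; ring.
Qed.

Lemma leq_add2_exp2 b : (2 <= b)%N -> (b.+2 <= 2 ^ b)%N.
Proof.
elim: b => // b IH; rewrite leq_eqVlt => /orP[/eqP <-//|/IH].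
by rewrite expnS; lia.
Qed.

Lemma leq_add3_exp2 b : (3 <= b)%N -> (b.+3 <= 2 ^ b)%N.
Proof.
elim: b => // b IH; rewrite leq_eqVlt => /orP[/eqP <-//|/IH].
by rewrite expnS; lia.
Qed.

Lemma exp_1addmx_nilp (R : pzRingType) n (N : 'M[R]_n.+1) m :
  N * N = 0 -> (1 + N) ^+ m = 1 + N *+ m.
Proof.
move=> NN; elim: m => [|m IH]; first by rewrite expr0 addr0.
by rewrite exprSr IH mulrDr mulr1 mulrDl mul1r mulrnAl NN mul0rn addr0 mulrSr addrA.
Qed.

Section WittOrders.

Variables (p : nat) (p_pr : prime p) (r e : nat) (Fq : finFieldType).
Hypotheses (r_gt0 : (0 < r)%N) (pcharFq : p \in [pchar Fq]).
Hypothesis (card_Fq : #|Fq| = (p ^ e)%N).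
Local Notation W := (witt p_pr r Fq).

Lemma witt_mulpX_neq0 (x : W) j : (j < r)%N -> x ord0 != 0 -> x *+ (p ^ j) != 0.
Proof.
move=> jr x0; apply: contra_neq x0 => E.
have jL : (j < r.-1.+1)%N by rewrite prednK.
have /eqP := witt_mulpX_top x pcharFq jL.
by rewrite E ffunE eq_sym expf_eq0 => /andP[_ /eqP].
Qed.

Lemma witt1_0 : (1 : W) ord0 = 1.
Proof. by rewrite ffunE. Qed.

(** By [exp_one_addpX] the p^(r - 1 - d)-th power is 1 + p^(r - 1) u with u_0
    equal to y_0. *)
Lemma witt_1addp_order (y : W) d : (0 < d < r)%N -> (2 < p)%N \/ (1 < d)%N ->
  y ord0 != 0 ->
  (1 + (p ^ d)%:R * y) ^+ (p ^ (r.-1 - d)) != 1 /\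
  exists s, (1 + (p ^ d)%:R * y) ^+ (p ^ s) = 1.
Proof.
move=> /andP[d_gt0 dr] pd y0; split; last first.
  have [s s0] := witt_nat_pX_eq0 p_pr r card_Fq.
  exists s; have [c ->] := exp_one_addpX y s p_pr d_gt0 pd.
  by rewrite addnC expnD natrM s0 !mul0r addr0.
have [c ->] := exp_one_addpX y (r.-1 - d) p_pr d_gt0 pd.
rewrite subnKC; last by rewrite -ltnS prednK.
rewrite -subr_eq0 addrC addKr mulr_natl; apply: witt_mulpX_neq0.
  by rewrite prednK.
have natE k : (k%:R : W) ord0 = k%:R.
  by elim: k => [|k IH]; rewrite ?ffunE // !mulrS witt0_add witt1_0 IH.
by rewrite witt0_add witt0_mul natE (pcharf0 pcharFq) mul0r addr0.
Qed.

(** The matrix is 1 + N with N an elementary nilpotent matrix, whose powers are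
    1 + m N; N is strictly lower triangular in order to apply [det_trig]. *)
Lemma elementary_order n : exists s (A : 'M[W]_n.+2),
  [/\ A ^+ (p ^ s) = 1, A ^+ (p ^ r.-1) != 1 & \det A = 1].
Proof.
have [s s0] := witt_nat_pX_eq0 p_pr r card_Fq.
pose N : 'M[W]_n.+2 := delta_mx 1 0.
have NN : N * N = 0 by apply: mul_delta_mx_0.
have NX m : (1 + N) ^+ m = 1 + m%:R *: N.
  by rewrite exp_1addmx_nilp // scaler_nat.
exists s, (1 + N); split.
- by rewrite NX s0 scale0r addr0.
- rewrite NX -subr_eq0 addrC addKr; apply/eqP => /matrixP/(_ 1 0).
  rewrite !mxE !eqxx mulr1; apply/eqP.
  by apply: witt_mulpX_neq0 => //; rewrite ?witt1_0 ?oner_eq0 // prednK.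
rewrite det_trig.
  rewrite big1 // => i _; rewrite !mxE eqxx.
  by case: (i =P 1) => [->|_]; rewrite ?addr0.
apply/is_trig_mxP => i j ij; rewrite !mxE.
have -> : (i == j) = false by apply/negbTE; rewrite neq_ltn ij.
have -> : (j == 0) = false.
  by apply/negbTE; rewrite -val_eqE /= -lt0n; apply: leq_ltn_trans ij.
by rewrite andbF addr0.
Qed.

(** For p odd the unit is 1 + p.  For p = 2 and q > 2 it is 1 + 2x with x_0
    different from 0 and 1, whose square 1 + 4(x + x^2) is of the form 1 + 4y
    with y_0 nonzero.  For q = 2 this is impossible and the unit is 5. *)
Lemma witt_unit_order : ((3 <= p)%N /\ (3 <= r)%N) \/ (4 <= r)%N ->
  (p ^ e = 2 -> 6 <= r)%N -> (0 < e)%N ->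
  exists k s (a : W),
    [/\ (r <= p ^ k)%N, a ^+ (p ^ s) = 1 & a ^+ (p ^ k) != 1].
Proof.
move=> le_r q2 e_gt0; have p_gt1 := prime_gt1 p_pr.
have [p3|p_le2] := ltnP 2 p.
  have [||//|ak [s as1]] := @witt_1addp_order 1 1.
  - lia.
  - by left.
  - by rewrite witt1_0 oner_eq0.
  exists (r.-1 - 1)%N, s, (1 + (p ^ 1)%:R * 1); split=> //.
  have [->|r4] : r = 3%N \/ (4 <= r)%N by lia.
    by rewrite expn1.
  apply: (@leq_trans (2 ^ (r.-1 - 1))); last by rewrite leq_exp2r //; lia.
  by apply: leq_trans (leq_add2_exp2 (_ : 2 <= r.-1 - 1)%N); lia.
have p2 : p = 2%N by lia.
have r4 : (4 <= r)%N by lia.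
have [qE2|q_gt2] : (p ^ e = 2 \/ 2 < p ^ e)%N.
  rewrite p2; case: (e) e_gt0 => [//|[|e'] _]; [by left | right].
  by rewrite !expnS; have := expn_gt0 2 e'; lia.
  have r6 := q2 qE2.
  have [||//|ak [s as1]] := @witt_1addp_order 1 2.
  - lia.
  - by right.
  - by rewrite witt1_0 oner_eq0.
  exists (r.-1 - 2)%N, s, (1 + (p ^ 2)%:R * 1); split=> //.
  by rewrite p2; apply: leq_trans (leq_add3_exp2 (_ : 3 <= r.-1 - 2)%N); lia.
have [x0 /andP[x00 x01]] : exists x0 : Fq, (x0 != 0) && (x0 != 1).
  apply/existsP; apply: contraTT q_gt2 => /existsPn no.
  rewrite -leqNgt -card_Fq -cardsT.
  have : (#|[set 0%R; 1%R : Fq]| <= 2)%N by rewrite cards2; case: eqP.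
  apply: leq_trans; apply: subset_leq_card; apply/subsetP => z _.
  by have := no z; rewrite !inE; case: eqP => //=; case: eqP.
pose x : W := Witt p_pr [ffun=> x0].
have sqE (R : comNzRingType) (z : R) :
    (1 + p%:R * z) ^+ p = 1 + (p ^ 2)%:R * (z + z * z) by rewrite p2; ring.
have [||//|ak [s as1]] := @witt_1addp_order (x + x * x) 2.
- lia.
- by right.
- rewrite witt0_add witt0_mul !ffunE -[X in X + _]mulr1 -mulrDr mulf_neq0 //.
  have -> : 1 + x0 = x0 - 1; last by rewrite subr_eq0.
  rewrite addrC; congr (_ + _); apply/eqP; rewrite -addr_eq0.
  have -> : 1 + 1 = p%:R :> Fq by rewrite p2.
  by rewrite (pcharf0 pcharFq).
exists (r.-1 - 2).+1, s.+1, (1 + p%:R * x); split.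
- by rewrite p2; apply: leq_trans (leq_add2_exp2 (_ : 2 <= _)%N); lia.
- by rewrite expnS exprM sqE.
- by rewrite expnS exprM sqE.
Qed.

End WittOrders.

(** * Non-isomorphism *)

Section MatrixGroups.

Variables (G : GL_or_SL) (n : nat) (R : finComUnitRingType).

Lemma points_of_torsion (A : 'M[R]_n.-1.+1) m : (0 < m)%N -> A ^+ m = 1 ->
  (G = SL -> \det A = 1) ->
  exists u : [subg points G n R], GLval (sgval u) = A.
Proof.
move=> m_gt0 Am detA.
have Au : A \is a GRing.unit.
  by rewrite -(unitrX_pos _ m_gt0) Am unitr1.
pose u : {'GL_n[R]} := FinRing.Unit Au.
have uG : u \in points G n R.
  rewrite /points; case: G detA => [_|dA]; first by rewrite inE.
  by rewrite /= inE; apply/eqP/dA.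
by exists (subg _ u); rewrite subgK.
Qed.

Lemma GLval_subgX (u : [subg points G n R]) k :
  GLval (sgval (u ^+ k)%g) = GLval (sgval u) ^+ k.
Proof.
by elim: k => [//|k IH]; rewrite expgS exprS -IH.
Qed.

Lemma subg_points_eq1 (u : [subg points G n R]) :
  GLval (sgval u) = 1 -> u = 1%g.
Proof. by move=> E; apply/val_inj/val_inj. Qed.

End MatrixGroups.

(** It suffices to find a matrix over the Witt vectors whose order is a power of
    p that exceeds a power p^k >= nr. *)
Lemma points_not_isomorphic (p n r k s : nat) (p_pr : prime p)
    (Fq : finFieldType) (F : fieldType) (G : GL_or_SL)
    (A : 'M[witt p_pr r Fq]_n.-1.+1) :
  (0 < n)%N -> (0 < r)%N -> p \in [pchar F] -> perfect_field F ->
  p \in [pchar Fq] -> (n * r <= p ^ k)%N ->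
  A ^+ (p ^ s) = 1 -> A ^+ (p ^ k) != 1 -> (G = SL -> \det A = 1) ->
  ~ alg_isomorphic
      (group_algebra F [subg points G n (witt p_pr r Fq)])
      (group_algebra F [subg points G n {poly %/ ('X^r : {poly Fq})}]).
Proof.
move=> n_gt0 r_gt0 charF perfF charFq le_nr As Ak detA iso.
have ps_gt0 : (0 < p ^ s)%N by rewrite expn_gt0 prime_gt0.
have [u uA] := points_of_torsion ps_gt0 As detA.
have us : (u ^+ (p ^ s) = 1)%g by apply: subg_points_eq1; rewrite GLval_subgX uA.
have uk : (u ^+ (p ^ k) = 1)%g.
  apply: (p_exponent_of_group_algebra charF perfF iso) us => h m hm.
  apply: subg_points_eq1; rewrite GLval_subgX.
  apply: (@GL_qpoly_p_exponent Fq r n.-1 r_gt0 p k _ m) => //.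
    by rewrite prednK.
  by rewrite -GLval_subgX hm.
by case/eqP: Ak; rewrite -uA -GLval_subgX uk.
Qed.

Theorem corollaryA (p q n r : nat) (p_pr : prime p)
    (Fq : finFieldType) (F : fieldType) (G : GL_or_SL)
    (q_pow : exists2 e : nat, (0 < e)%N & q = (p ^ e)%N)
    (card_Fq : #|Fq| = q)
    (n_gt0 : (0 < n)%N) (r_gt0 : (0 < r)%N) (le_n_p : (n <= p)%N)
    (charF : p \in [pchar F]) (perfF : perfect_field F)
    (cases : [\/ r = 2%N /\ (2 * n <= p)%N,
                 r = 3%N /\ (3 <= p)%N |
                 (4 <= r)%N /\ (2 <= p)%N])
    (* For n = 1 this excludes exactly the cases in which the two groups, hence
       the two algebras, are isomorphic. *)
    (nondegenerate : (2 <= n)%N \/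
                     [/\ G = GL, (3 <= r)%N & q = 2%N -> (6 <= r)%N]) :
  ~ alg_isomorphic
      (group_algebra F [subg points G n (witt p_pr r Fq)])
      (group_algebra F [subg points G n {poly %/ ('X^r : {poly Fq})}]).
Proof.
have [e e_gt0 qE] := q_pow; rewrite qE in card_Fq nondegenerate.
have charFq : p \in [pchar Fq] by apply: (card_finPcharP card_Fq).
have p_gt1 := prime_gt1 p_pr.
have [n_gt1|n_le1] := leqP 2 n.
  have le_nr : (n * r <= p ^ r.-1)%N.
    case: cases => [[-> le2n]|[-> p3]|[r4 _]]; first by rewrite expn1; lia.
      by rewrite /= expnS expn1; nia.
    rewrite -[r.-1](@prednK r.-1) ?expnS; last by lia.
    apply: leq_mul => //.
    apply: (@leq_trans (2 ^ r.-2)); last by rewrite leq_exp2r //; lia.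
    by apply: leq_trans (leq_add2_exp2 (_ : 2 <= r.-2)%N); lia.
  move: (n) n_gt0 n_gt1 le_nr; case=> [//|[//|n']] n_gt0' _ le_nr.
  have [s [A [As Ak detA]]] := elementary_order p_pr r_gt0 charFq card_Fq n'.
  exact: (@points_not_isomorphic p n'.+2 r r.-1 s p_pr Fq F G A).
have n1 : n = 1%N by lia.
case: nondegenerate => [|[GE r3 q2]]; first by rewrite n1.
have le_r : ((3 <= p)%N /\ (3 <= r)%N) \/ (4 <= r)%N.
  by case: cases => [[]|[]|[]]; lia.
have [k [s [a [rk as1 ak]]]] :=
  witt_unit_order p_pr r_gt0 charFq card_Fq le_r q2 e_gt0.
apply: (@points_not_isomorphic p n r k s p_pr Fq F G a%:M) => //.
- by rewrite n1 mul1n.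
- by rewrite -rmorphXn /= as1.
- rewrite -rmorphXn /=; apply: contra_neq ak => /matrixP/(_ 0 0).
  by rewrite !mxE eqxx !mulr1n.
- by rewrite GE.
Qed.
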